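(* Let $\Gamma$ be a $\delta$-hyperbolic graph. Suppose $\mathcal{L}$ is a set of geodesics in $\Gamma$ such that any two vertices of $\Gamma$ are joined by a geodesic in $\mathcal{L}$. If $\mathcal{L}$ satisfies property B with constants $\ell$, $k=2\delta$ and $D$, then $\Gamma$ has property $A_1$.
   Context: A graph $\Gamma$ is regarded as a connected geodesic metric space with all edges of length 1; $V(\Gamma)$ is its vertex set. A geodesic metric space is $\delta$-hyperbolic ($\delta\ge 0$) if in every geodesic triangle each side is contained in the $\delta$-neighborhood of the union of the other two sides. $N(x;r)$ denotes the (closed) ball of radius $r$ centered at $x$. Property B: let $\mathcal{L}$ be a set of geodesics in $\Gamma$ such that any two vertices are connected by a member of $\mathcal{L}$. For $a,b\in V(\Gamma)$ let $\mathcal{L}(a,b)$ be the set of all geodesics in $\mathcal{L}$ connecting $a$ and $b$, and $G(a,b)=\bigcup\mathcal{L}(a,b)\subset\Gamma$. For $A,B\subset V(\Gamma)$ let $\mathcal{L}(A,B)=\bigcup\{\mathcal{L}(a,b)\mid a\in A,\,b\in B\}$ and $G(A,B)=\bigcup\mathcal{L}(A,B)$. Write $G(a,b;r)=G(N(a;r)\cap V(\Gamma),\,N(b;r)\cap V(\Gamma))$. The set $\mathcal{L}$ satisfies property B with constants $\ell\ge 0$, $k\ge 0$ and $D\in\{1,2,3,\dots\}$ if for all $a,b\in V(\Gamma)$, $r\in\mathbb{N}$ and every vertex $c\in G(a,b)$ with $d(c,\{a,b\})\ge r+\ell$: the set of vertices in $G(a,b;r)\cap N(c;k)$ has at most $D$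 elements, and any geodesic connecting $N(a;r)$ to $N(b;r)$ intersects $N(c;k)$. Property $A_1$: a metric space $X$ has property $A_1$ if there exist maps $a^n:X\to\ell^1(X)$, $x\mapsto a^n_x$ ($n\in\mathbb{N}$), such that $\|a^n_x\|_1=1$ and $a^n_x(y)\ge 0$ for all $x,y\in X$ and $n\in\mathbb{N}$, and (1) there is a function $R=R(n)$ with $\operatorname{supp}(a^n_x)\subset N(x;R(n))$ for all $x\in X$ and all $n$; (2) for every $K>0$, $\lim_{n\to\infty}\sup_{d(x,y)<K}\|a^n_x-a^n_y\|_1=0$. *)

(* Defs.v *)
From HB Require Import structures.
From mathcomp Require Import all_boot all_order all_algebra.
From mathcomp Require Import all_classical all_reals all_analysis.
From mathcomp Require Import lra.
Set Implicit Arguments.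
Unset Strict Implicit.
Unset Printing Implicit Defensive.
Import Order.TTheory GRing.Theory Num.Theory.
Local Open Scope classical_set_scope.
Local Open Scope ring_scope.

(* No finiteness or local finiteness is assumed; loops and multiple edges are
   allowed.  The orientation of an edge only serves to parametrise it.  A
   simple graph is the case where [edge] contains each adjacent pair once. *)
Record multigraph := Multigraph {
  vertex : Type;
  edge : Type;
  source : edge -> vertex;
  target : edge -> vertex }.

Definition adjacent (G : multigraph) (u v : vertex G) : Prop :=
  exists e : edge G,
    (source e = u /\ target e = v) \/ (source e = v /\ target e = u).

Fixpoint walk (G : multigraph) (n : nat) (u v : vertex G) : Prop :=
  if n is m.+1 then exists2 w, adjacent u w & walk m w v else u = v.

Record graph := Graph {
  graph_multigraph :> multigraph;
  graph_connected : forall u v : vertex graph_multigraph,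
    exists n, walk n u v }.

Section VertexDistance.
Context (G : graph).
Implicit Types u v w : vertex G.

Lemma exists_walkb u v : exists n, `[< walk n u v >].
Proof. by have [n un] := graph_connected u v; exists n; apply/asboolP. Qed.

Definition vdist u v : nat := ex_minn (exists_walkb u v).

Lemma vdist_walk u v : walk (vdist u v) u v.
Proof. by rewrite /vdist; case: ex_minnP => n /asboolP. Qed.

Lemma vdist_min n u v : walk n u v -> (vdist u v <= n)%N.
Proof. by rewrite /vdist; case: ex_minnP => m _ + /asboolP; apply. Qed.

Lemma adjacent_sym u v : adjacent u v -> adjacent v u.
Proof. by case=> e [] ?; exists e; [right|left]. Qed.

Lemma walk_cat m n u v w : walk m u v -> walk n v w -> walk (m + n) u w.
Proof.
elim: m u => [|m IHm] u /=; first by move->.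
by case=> x ux xv vw; exists x => //; apply: IHm xv vw.
Qed.

Lemma walk_sym n u v : walk n u v -> walk n v u.
Proof.
elim: n u => [|n IHn] u /=; first by [].
case=> w uw /IHn vw; have wu : walk 1 w u by exists u => //; apply: adjacent_sym.
by have := walk_cat vw wu; rewrite addn1.
Qed.

Lemma vdistC u v : vdist u v = vdist v u.
Proof.
by apply/eqP; rewrite eqn_leq !vdist_min //; apply: walk_sym; apply: vdist_walk.
Qed.

Lemma vdistxx u : vdist u u = 0%N.
Proof. by apply/eqP; rewrite -leqn0 vdist_min. Qed.

Lemma vdist_eq0 u v : vdist u v = 0%N -> u = v.
Proof. by move=> uv0; have := vdist_walk u v; rewrite uv0. Qed.

Lemma vdist_triangle v u w : (vdist u w <= vdist u v + vdist v w)%N.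
Proof. by apply: vdist_min; apply: walk_cat; apply: vdist_walk. Qed.

Lemma vdist_edge (e : edge G) : (vdist (source e) (target e) <= 1)%N.
Proof. by apply: vdist_min; exists (target e) => //; exists e; left. Qed.

End VertexDistance.

(* The geometric realisation with all edges of length 1: the vertices and, for
   each edge [e], the points of its interior at distance [t] along [e] from
   [source e]. *)
Inductive realization (R : realType) (G : graph) : Type :=
| Vertex of vertex G
| Interior of edge G & {t : R | 0 < t < 1}.

Arguments Vertex {R G}.
Arguments Interior {R G}.

HB.instance Definition _ (R : realType) (G : graph) :=
  gen_eqMixin (realization R G).
HB.instance Definition _ (R : realType) (G : graph) :=
  gen_choiceMixin (realization R G).

Section RealizationMetric.
Context {R : realType} {G : graph}.
Implicit Types (p q r : realization R G) (b c : bool).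

(* A point is seen as lying on a segment whose two ends, indexed by [bool], are
   vertices ([end_vertex]) at distance [end_offset] from it along the segment;
   the segment is degenerate when the point is a vertex. *)
Definition end_vertex p b : vertex G :=
  match p with
  | Vertex v => v
  | Interior e _ => if b then target e else source e
  end.

Definition end_offset p b : R :=
  match p with
  | Vertex _ => 0
  | Interior _ t => if b then 1 - sval t else sval t
  end.

Definition length_via p q b c : R :=
  end_offset p b + (vdist (end_vertex p b) (end_vertex q c))%:R
  + end_offset q c.

Definition dist_via p q : R :=
  Num.min (Num.min (length_via p q false false) (length_via p q false true))
          (Num.min (length_via p q true false) (length_via p q true true)).

(* The path metric: a shortest path either passes through vertices or stays
   inside a single edge; the metric space axioms are checked below. *)
Definition rdist p q : R :=
  match p, q with
  | Interior e s, Interior f t =>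
      if `[< e = f >] then Num.min `|sval s - sval t| (dist_via p q)
      else dist_via p q
  | _, _ => dist_via p q
  end.

Definition same_edge p q : Prop :=
  match p, q with
  | Interior e _, Interior f _ => e = f
  | _, _ => False
  end.

Definition direct p q : R := `|end_offset p false - end_offset q false|.

Lemma dist_via_le p q b c : dist_via p q <= length_via p q b c.
Proof. by rewrite /dist_via !ge_min; case: b c => [] []; rewrite lexx ?orbT. Qed.

Lemma dist_viaP p q : exists b c, dist_via p q = length_via p q b c.
Proof.
rewrite /dist_via; set x := Num.min (length_via _ _ _ _) _.
set y := Num.min (length_via _ _ true _) _.
by rewrite [Num.min x y]minElt [x]minElt [y]minElt; do ![case: ifP => _];
  [exists false, false|exists false, true|exists true, false|exists true, true].
Qed.

Lemma rdistP p q :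
  (same_edge p q /\ rdist p q = direct p q) \/
  (exists b c, rdist p q = length_via p q b c).
Proof.
have via : rdist p q = dist_via p q ->
    exists b c, rdist p q = length_via p q b c.
  by move=> ->; apply: dist_viaP.
case: p q via => [u|e s] [v|f t] /= via; try by right; apply: via.
move: via; case: asboolP => [ef|_] via; last by right; apply: via.
by move: via; rewrite minElt; case: ifP => _ via; [left|right; apply: via].
Qed.

Lemma rdist_le p q b c : rdist p q <= length_via p q b c.
Proof.
apply: le_trans (dist_via_le p q b c).
case: p q => [u|e s] [v|f t] //=.
by case: asboolP => // _; rewrite ge_min lexx orbT.
Qed.

Lemma rdist_le_direct p q : same_edge p q -> rdist p q <= direct p q.
Proof.
case: p q => [u|e s] [v|f t] //= ef.
by case: asboolP => // _; rewrite ge_min lexx.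
Qed.

Lemma end_offset_ge0 p b : 0 <= end_offset p b.
Proof.
case: p => [//|e t] /=; have /andP[t0 t1] := svalP t.
by case: b; rewrite ?subr_ge0 ltW.
Qed.

Lemma end_offset_eq0 p b : end_offset p b = 0 -> exists v, p = Vertex v.
Proof.
case: p => [v _|e t] /=; first by exists v.
by have /andP[t0 t1] := svalP t; case: b => t00; lra.
Qed.

Lemma vdist_ends p b c :
  (vdist (end_vertex p b) (end_vertex p c))%:R <= end_offset p b + end_offset p c.
Proof.
have off0 := end_offset_ge0 p.
case: (eqVneq b c) => [->|bc]; first by rewrite vdistxx addr_ge0.
case: p off0 => [v|e t] _ /=; first by rewrite vdistxx addr0.
have le1 : (vdist (source e) (target e))%:R <= 1 :> R by rewrite lern1 vdist_edge.
have le1' : (vdist (target e) (source e))%:R <= 1 :> R by rewrite vdistC.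
by case: b c bc => [] [] // _; lra.
Qed.

Lemma same_edge_offset p q b : same_edge p q ->
  end_vertex p b = end_vertex q b /\
  end_offset p b <= direct p q + end_offset q b.
Proof.
case: p q => [u|e s] [v|f t] //= ->; split=> //; rewrite /direct /=.
have := ler_norm (sval s - sval t); have := ler_norm (sval t - sval s).
by rewrite distrC; case: b; lra.
Qed.

Lemma directC p q : direct p q = direct q p.
Proof. exact: distrC. Qed.

Lemma same_edge_sym p q : same_edge p q -> same_edge q p.
Proof. by case: p q => [u|e s] [v|f t]. Qed.

Lemma length_viaC p q b c : length_via p q b c = length_via q p c b.
Proof. by rewrite /length_via vdistC addrC addrA addrAC. Qed.

Lemma rdist_sym p q : rdist p q = rdist q p.
Proof.
have le x y : rdist x y <= rdist y x.
  case: (rdistP y x) => [[/same_edge_sym xy ->]|[b [c ->]]].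
    by rewrite directC; apply: rdist_le_direct.
  by rewrite length_viaC; apply: rdist_le.
by apply/eqP; rewrite eq_le !le.
Qed.

Lemma length_via_ge0 p q b c : 0 <= length_via p q b c.
Proof. by rewrite /length_via !addr_ge0 ?end_offset_ge0. Qed.

Lemma rdist_ge0 p q : 0 <= rdist p q.
Proof.
case: (rdistP p q) => [[_ ->]|[b [c ->]]]; first exact: normr_ge0.
exact: length_via_ge0.
Qed.

Lemma rdistxx p : rdist p p = 0.
Proof.
apply/eqP; rewrite eq_le rdist_ge0 andbT; case: p => [v|e t].
  by apply: le_trans (rdist_le _ _ true true) _; rewrite /length_via /= vdistxx !addr0.
apply: le_trans (rdist_le_direct _) _; first by [].
by rewrite /direct subrr normr0.
Qed.

Lemma rdist_positivity p q : rdist p q = 0 -> p = q.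
Proof.
case: (rdistP p q) => [[pq ->]|[b [c ->]]].
  case: p q pq => [u|e s] [v|f t] //= ->; rewrite /direct /= => /normr0_eq0/eqP.
  by rewrite subr_eq0 => /eqP st; congr Interior; apply: val_inj.
rewrite /length_via => len0.
have p0 := end_offset_ge0 p b; have q0 := end_offset_ge0 q c.
have d0 : 0 <= (vdist (end_vertex p b) (end_vertex q c))%:R :> R by [].
have [u pu] : exists u, p = Vertex u by apply: (@end_offset_eq0 p b); lra.
have [v qv] : exists v, q = Vertex v by apply: (@end_offset_eq0 q c); lra.
have : (vdist (end_vertex p b) (end_vertex q c))%:R = 0 :> R by lra.
by rewrite pu qv /= => /eqP; rewrite pnatr_eq0 => /eqP/vdist_eq0 ->.
Qed.

Lemma rdist_triangle q p r : rdist p r <= rdist p q + rdist q r.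
Proof.
have direct_via x y z b c : same_edge x y ->
    rdist x z <= direct x y + length_via y z b c.
  move=> xy; apply: le_trans (rdist_le x z b c) _.
  by have [] := same_edge_offset b xy; rewrite /length_via => ->; lra.
case: (rdistP p q) => [[pq ->]|[b [c ->]]];
  case: (rdistP q r) => [[qr ->]|[b' [c' ->]]].
- have pr : same_edge p r.
    by case: p q r pq qr => [?|? ?] [?|? ?] [?|? ?] //= -> ->.
  apply: le_trans (rdist_le_direct pr) _; exact: ler_distD.
- exact: direct_via.
- rewrite rdist_sym addrC directC length_viaC.
  by apply: direct_via; apply: same_edge_sym.
- apply: le_trans (rdist_le p r b c') _; rewrite /length_via.
  have qq := vdist_ends q c b'.
  have t1 := vdist_triangle (end_vertex q c) (end_vertex p b) (end_vertex r c').
  have t2 := vdist_triangle (end_vertex q b') (end_vertex q c) (end_vertex r c').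
  rewrite -(ler_nat R) natrD in t1; rewrite -(ler_nat R) natrD in t2.
  lra.
Qed.

End RealizationMetric.

HB.instance Definition _ (R : realType) (G : graph) :=
  @isMetric.Build R (realization R G) rdist rdistxx rdist_positivity rdist_sym
    rdist_triangle.

Section MetricSpace.
Context {R : realType} {X : metricType R}.
Implicit Types (x y z p q : X) (A B C S : set X).

Definition cball x (r : R) : set X := [set y | mdist x y <= r].

(* Closed, so that [delta = 0] is meaningful; for the compact sets [A] to which
   it is applied this is the set of points at distance at most [r] from [A]. *)
Definition neighborhood (r : R) A : set X :=
  [set p | exists2 q, A q & mdist p q <= r].

(* Geodesics are unparametrised: [S] is the image of an isometric embedding of
   an interval, with ends [x] and [y]. *)
Definition geodesic_between S x y : Prop :=
  exists g : R -> X,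
    [/\ {in `[0, mdist x y] &, forall s t, mdist (g s) (g t) = `|s - t|},
        g 0 = x, g (mdist x y) = y & S = g @` `[0, mdist x y]].

Definition geodesic S : Prop := exists x y, geodesic_between S x y.

Definition geodesic_triangle A B C : Prop :=
  exists x y z,
    [/\ geodesic_between A x y, geodesic_between B y z & geodesic_between C z x].

End MetricSpace.

Definition hyperbolic (R : realType) (X : metricType R) (delta : R) : Prop :=
  0 <= delta /\
  forall A B C : set X, geodesic_triangle A B C ->
    [/\ A `<=` neighborhood delta (B `|` C),
        B `<=` neighborhood delta (C `|` A) &
        C `<=` neighborhood delta (A `|` B)].

Section PropertyB.
Context {R : realType} {G : graph} (L : set (set (realization R G))).
Implicit Types (a b c v : vertex G) (A B : set (vertex G)).

Definition joining a b : set (set (realization R G)) :=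
  [set S | L S /\ geodesic_between S (Vertex a) (Vertex b)].

Definition joining_sets A B : set (set (realization R G)) :=
  \bigcup_(a in A) \bigcup_(b in B) joining a b.

Definition span_points a b : set (realization R G) :=
  \bigcup_(S in joining a b) S.

Definition span_sets A B : set (realization R G) :=
  \bigcup_(S in joining_sets A B) S.

Definition vertex_ball a (r : R) : set (vertex G) :=
  [set v | cball (Vertex a : realization R G) r (Vertex v)].

Definition span_balls a b (r : R) : set (realization R G) :=
  span_sets (vertex_ball a r) (vertex_ball b r).

Definition property_B (l k : R) (D : nat) : Prop :=
  [/\ 0 <= l, 0 <= k, (0 < D)%N &
   forall a b (r : nat) c,
     span_points a b (Vertex c) ->
     r%:R + l <= Num.min (mdist (Vertex c : realization R G) (Vertex a))
                         (mdist (Vertex c : realization R G) (Vertex b)) ->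
     ([set v | span_balls a b r%:R (Vertex v) /\
              cball (Vertex c : realization R G) k (Vertex v)] #<= `I_D)%card /\
     forall (S : set (realization R G)) p q,
       cball (Vertex a) r%:R p -> cball (Vertex b) r%:R q ->
       geodesic_between S p q -> S `&` cball (Vertex c) k !=set0].

End PropertyB.

Definition l1norm (R : realType) (X : choiceType) (f : X -> R) : \bar R :=
  \esum_(x in [set: X]) `|f x|%:E.

(* Adjoining [0] to the set of norms only matters when [X] is empty, where the
   supremum in [0, +oo] is 0 while [ereal_sup set0] is -oo. *)
Definition property_A1 (R : realType) (X : metricType R) : Prop :=
  exists a : nat -> X -> X -> R,
  [/\ forall n x, summable [set: X] (EFin \o a n x),
      forall n x, l1norm (a n x) = 1%E,
      forall n x y, 0 <= a n x y,
      exists rad : nat -> R,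
        forall n x, [set y | a n x y != 0] `<=` cball x (rad n) &
      forall K : R, 0 < K ->
        (fun n => ereal_sup (0%E |`
          [set l1norm (a n xy.1 \- a n xy.2) |
             xy in [set xy : X * X | mdist xy.1 xy.2 < K]])) @ \oo --> 0%E].

(* Main.v *)
Require Import Defs.
From HB Require Import structures.
From mathcomp Require Import all_boot all_order all_algebra.
From mathcomp Require Import all_classical all_reals all_analysis.
From mathcomp Require Import finmap lra zify.
Import Order.TTheory GRing.Theory Num.Theory.
Local Open Scope classical_set_scope.
Local Open Scope ring_scope.

(* Fix a base vertex [z].  For a vertex [x], a level [s] and a radius [k], let
   [S(x, s, k)] be the set of vertices at distance [s] from [z] on the geodesics of
   [L] joining the [k]-ball around [x] to [z].  By thin triangles this set lies in
   the [2 * delta]-ball of a vertex of a geodesic from [x] to [z], so property B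
   bounds its cardinal by [D] independently of [k].  It increases with [k], and
   [S(x, s, k)] is contained in [S(y, s, k + 1)] when [x] and [y] are adjacent.
   Among the first [m] values of [k], all but at most [D] satisfy
   [S(x, s, k) = S(x, s, k + 1)], and likewise for [y]; for the other values of
   [k], [S(x, s, k) = S(y, s, k)].  Hence averaging the uniform probabilities on
   these sets over [m] values of [k] and [m] levels counted from [x] gives
   probabilities at distance [O(1 / m)] for adjacent [x] and [y]. *)

(** * Sums and differences in the l1 norm *)

Section L1Norm.
Context {R : realType} {X : choiceType}.
Implicit Types (f g h : X -> R) (w : R) (A B : set X).

Lemma l1norm_ge0 f : (0 <= l1norm f)%E.
Proof. by apply: esum_ge0 => x _; rewrite lee_fin. Qed.

Lemma l1norm0 : l1norm (cst 0 : X -> R) = 0%E.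
Proof. by apply: esum1 => x _; rewrite normr0. Qed.

Lemma le_l1normD f g : (l1norm (f \+ g)%R <= l1norm f + l1norm g)%E.
Proof.
rewrite /l1norm -esumD; [|by move=> x _; rewrite lee_fin..].
by apply: le_esum => x _; rewrite -EFinD lee_fin ler_normD.
Qed.

Lemma l1normB f g : l1norm (f \- g)%R = l1norm (g \- f)%R.
Proof. by apply: eq_esum => x _ /=; rewrite distrC. Qed.

Lemma le_l1normB f g : (l1norm (f \- g)%R <= l1norm f + l1norm g)%E.
Proof.
rewrite /l1norm -esumD; [|by move=> x _; rewrite lee_fin..].
by apply: le_esum => x _; rewrite -EFinD lee_fin ler_normB.
Qed.

Lemma le_l1dist g f h :
  (l1norm (f \- h)%R <= l1norm (f \- g)%R + l1norm (g \- h)%R)%E.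
Proof.
have -> : f \- h = (f \- g) \+ (g \- h).
  by apply/funext => x /=; rewrite addrA subrK.
exact: le_l1normD.
Qed.

Lemma l1norm_sum {I : choiceType} (r : seq I) (F : I -> X -> R) :
  (forall i x, 0 <= F i x) ->
  l1norm (fun x => \sum_(i <- r) F i x) = (\sum_(i <- r) l1norm (F i))%E.
Proof.
move=> F0; rewrite /l1norm -esum_sum; last by move=> *; rewrite lee_fin.
apply: eq_esum => x _; rewrite sumEFin ger0_norm ?sumr_ge0//.
by congr (_%:E); apply: eq_bigr => i _; rewrite ger0_norm.
Qed.

Lemma le_l1norm_sum {I : choiceType} (r : seq I) (F : I -> X -> R) :
  (l1norm (fun x => \sum_(i <- r) F i x)%R <= \sum_(i <- r) l1norm (F i))%E.
Proof.
rewrite /l1norm -esum_sum; last by move=> *; rewrite lee_fin.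
by apply: le_esum => x _; rewrite sumEFin lee_fin ler_norm_sum.
Qed.

Lemma le_l1dist_sum {I : choiceType} (r : seq I) (F G : I -> X -> R) :
  (l1norm ((fun x => \sum_(i <- r) F i x) \- (fun x => \sum_(i <- r) G i x))%R
   <= \sum_(i <- r) l1norm (F i \- G i)%R)%E.
Proof.
rewrite [_ \- _](_ : _ = fun x => \sum_(i <- r) (F i \- G i) x).
  exact: le_l1norm_sum.
by apply/funext => x /=; rewrite sumrB.
Qed.

(** [F] at index [t] is matched with [G] at index [t + 1], both at level [M - t]; only the last [F]
    and the first [G] stay unmatched. This serves two vertices whose starting levels differ by
    one. *)
Lemma le_l1dist_shift (F G : nat -> X -> R) (M m : nat) :
  (l1norm ((fun x => \sum_(0 <= t < m) F (M - t)%N x) \-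
           (fun x => \sum_(0 <= t < m) G (M.+1 - t)%N x))%R <=
   \sum_(0 <= t < m.-1) l1norm (F (M - t)%N \- G (M - t)%N)%R +
   (l1norm (F (M - m.-1)%N) + l1norm (G M.+1)))%E.
Proof.
case: m => [|n] /=.
  rewrite [_ \- _](_ : _ = cst 0); last by apply/funext => x /=; rewrite !big_nil subrr.
  by rewrite l1norm0 !adde_ge0 ?l1norm_ge0 ?sume_ge0// => ? _; rewrite l1norm_ge0.
rewrite [_ \- _](_ : _ =
    ((fun x => \sum_(0 <= t < n) F (M - t)%N x) \-
     (fun x => \sum_(0 <= t < n) G (M - t)%N x)) \+ (F (M - n)%N \- G M.+1)).
  apply: le_trans (le_l1normD _ _) _.
  by apply: leeD; [exact: le_l1dist_sum|exact: le_l1normB].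
apply/funext => x /=; rewrite big_nat_recr//= big_nat_recl//= subn0.
lra.
Qed.

(** * Uniform weights on finite sets *)

Definition card (A : set X) : nat := #|` fset_set A|%N.

(* Junk value: the zero function when [A] is infinite or empty. *)
Definition uniform (w : R) (A : set X) (x : X) : R :=
  if x \in A then w / (card A)%:R else 0.

Lemma uniform_ge0 w A x : 0 <= w -> 0 <= uniform w A x.
Proof. by move=> w0; rewrite /uniform; case: ifP => // _; rewrite divr_ge0. Qed.

Lemma card_gt0 {A x} : finite_set A -> A x -> (0 < card A)%N.
Proof.
move=> finA Ax; rewrite /card cardfs_gt0; apply/fset0Pn; exists x.
by rewrite in_fset_set// mem_set.
Qed.

Lemma le_card {A B} : finite_set B -> A `<=` B -> (card A <= card B)%N.
Proof.
move=> finB AB; have finA := sub_finite_set AB finB.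
by apply: fsubset_leq_card; rewrite -fset_set_sub.
Qed.

Lemma eq_card_sub {A B} : finite_set B -> A `<=` B -> (card B <= card A)%N -> A = B.
Proof.
move=> finB AB BA; have finA := sub_finite_set AB finB.
apply: fset_set_inj => //; apply/eqP; rewrite eqEfcard BA andbT.
by rewrite -fset_set_sub.
Qed.

Lemma l1norm_uniform w A : 0 <= w -> finite_set A -> A !=set0 ->
  l1norm (uniform w A) = w%:E.
Proof.
move=> w0 finA [x Ax]; have A0 := card_gt0 finA Ax.
rewrite /l1norm -[RHS](_ : \esum_(i in A) (w / (card A)%:R)%:E = _)%E.
  rewrite [RHS]esum_mkcond; apply: eq_esum => y _.
  rewrite ger0_norm ?uniform_ge0// /uniform; by case: ifP.
rewrite esum_fset// => [|y _]; last by rewrite lee_fin divr_ge0.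
rewrite fsbig_finite// sumEFin /= big_const_seq count_predT iter_addr_0.
by rewrite -/(card A) -[_ *+ _]mulr_natr divfK// pnatr_eq0 -lt0n.
Qed.

(* Either both differences of cardinals vanish, and then [A = B], or the right
   hand side is at least the trivial bound [2 * w]. *)
Lemma l1dist_uniform w A B A' B' : 0 <= w -> finite_set A' -> finite_set B' ->
  A !=set0 -> B !=set0 -> A `<=` A' -> B `<=` B' -> A `<=` B' -> B `<=` A' ->
  (l1norm (uniform w A \- uniform w B)%R <=
   (2 * w * (((card A')%:R - (card A)%:R) + ((card B')%:R - (card B)%:R)))%:E)%E.
Proof.
move=> w0 finA' finB' A0 B0 AA' BB' AB' BA'.
have finA := sub_finite_set AA' finA'; have finB := sub_finite_set BB' finB'.
have leA := le_card finA' AA'; have leB := le_card finB' BB'.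
have [small|big] := leqP (card A' + card B') (card A + card B).
  have AB : A = B.
    have eA : A = A' by apply: eq_card_sub => //; lia.
    have eB : B = B' by apply: eq_card_sub => //; lia.
    by apply/seteqP; split; [rewrite eB|rewrite eA].
  rewrite AB [_ \- _](_ : _ = cst 0) ?l1norm0; last first.
    by apply/funext => x /=; rewrite subrr.
  rewrite lee_fin mulr_ge0 ?mulr_ge0// -AB addr_ge0// ?subr_ge0 ?ler_nat//.
  by rewrite AB.
apply: (@le_trans _ _ (l1norm (uniform w A) + l1norm (uniform w B))%E).
  exact: le_l1normB.
rewrite !l1norm_uniform// -EFinD lee_fin.
have : (card A + card B + 1)%:R <= (card A' + card B')%:R :> R by rewrite ler_nat addn1.
by rewrite !natrD; nra.
Qed.

(** Summed over [k], the bounds of [l1dist_uniform] telescope to [2 * w] times the total growth of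
    the two cardinals, each of which grows by at most [D]. *)
Lemma l1dist_uniform_chain (m D : nat) (w : R) (S T : nat -> set X) : 0 <= w ->
  (forall k, (k <= m)%N -> [/\ finite_set (S k), S k !=set0 & (card (S k) <= D)%N]) ->
  (forall k, (k <= m)%N -> [/\ finite_set (T k), T k !=set0 & (card (T k) <= D)%N]) ->
  (forall k, S k `<=` S k.+1) -> (forall k, T k `<=` T k.+1) ->
  (forall k, S k `<=` T k.+1) -> (forall k, T k `<=` S k.+1) ->
  (\sum_(0 <= k < m) l1norm (uniform w (S k) \- uniform w (T k))%R <=
   (w * (4 * D)%:R)%:E)%E.
Proof.
move=> w0 Sok Tok SS TT ST TS.
pose F (U : nat -> set X) k : R := (card (U k))%:R.
apply: (@le_trans _ _ (\sum_(0 <= k < m)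
    (2 * w * ((F S k.+1 - F S k) + (F T k.+1 - F T k)))%:E)%E).
  rewrite big_nat [leRHS]big_nat; apply: lee_sum => k /andP[_ km].
  have [_ ? _] := Sok _ (ltnW km); have [_ ? _] := Tok _ (ltnW km).
  have [? _ _] := Sok _ km; have [? _ _] := Tok _ km.
  exact: l1dist_uniform.
have [_ _ cS] := Sok _ (leqnn m); have [_ _ cT] := Tok _ (leqnn m).
rewrite sumEFin lee_fin -mulr_sumr big_split /= !telescope_sumr//.
have {}cS : F S m <= D%:R by rewrite ler_nat.
have {}cT : F T m <= D%:R by rewrite ler_nat.
have S0 : 0 <= F S 0%N by []. have T0 : 0 <= F T 0%N by [].
rewrite natrM; nra.
Qed.

End L1Norm.

(** * Distances along a geodesic *)

Section Geodesics.
Context {R : realType} {X : metricType R}.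
Implicit Types (S : set X) (x y p q : X).

Lemma geodesic_between_sym {S x y} :
  geodesic_between S x y -> geodesic_between S y x.
Proof.
move=> [g [iso g0 gd ->]].
have d0 : 0 <= mdist x y by exact: mdist_ge0.
rewrite /geodesic_between [mdist y x]metric_sym.
exists (fun t => g (mdist x y - t)); split.
- move=> s t /[!in_itv]/= /andP[s0 s1] /andP[t0 t1].
  by rewrite iso ?in_itv/= ?subr_ge0 ?s1 ?t1 ?gerBl ?s0 ?t0// opprB addrC addrA subrK distrC.
- by rewrite subr0.
- by rewrite subrr.
- apply/seteqP; split=> _ [t /= /[!in_itv]/= /andP[t0 t1] <-];
    exists (mdist x y - t) => //=; rewrite ?in_itv/= ?subr_ge0 ?t1 ?gerBl ?t0 //.
  by rewrite opprB addrC subrK.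
Qed.

Lemma geodesicD {S x y p} : geodesic_between S x y -> S p ->
  mdist x p + mdist p y = mdist x y.
Proof.
move=> [g [iso g0 gd ->]] [t /= tin <-]; have d0 : 0 <= mdist x y by exact: mdist_ge0.
have /andP[t0 t1] : 0 <= t <= mdist x y by rewrite in_itv in tin.
have in0 : 0 \in `[0, mdist x y]%R by rewrite in_itv/= lexx.
have ind : mdist x y \in `[0, mdist x y]%R by rewrite in_itv/= lexx d0.
rewrite -[in mdist x (g t)]g0 -[in mdist (g t) y]gd !iso// sub0r normrN ger0_norm//.
by rewrite ler0_norm ?subr_le0//; lra.
Qed.

Lemma geodesic_dist {S x y p q} : geodesic_between S x y -> S p -> S q ->
  mdist p q = `|mdist p y - mdist q y|.
Proof.
move=> [g [iso g0 gd ->]] [s /= sin <-] [t /= tin <-].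
have d0 : 0 <= mdist x y by exact: mdist_ge0.
have ind : mdist x y \in `[0, mdist x y]%R by rewrite in_itv/= lexx d0.
rewrite -[in mdist (g s) y]gd -[in mdist (g t) y]gd !iso//.
have /andP[s0 s1] : 0 <= s <= mdist x y by rewrite in_itv in sin.
have /andP[t0 t1] : 0 <= t <= mdist x y by rewrite in_itv in tin.
rewrite (@ler0_norm _ (s - mdist x y)) ?subr_le0// (@ler0_norm _ (t - mdist x y)) ?subr_le0//.
by rewrite distrC; congr `|_|; lra.
Qed.

Lemma geodesic_at {S x y} {s : R} : geodesic_between S x y -> 0 <= s <= mdist x y ->
  exists2 p, S p & mdist p y = s.
Proof.
move=> /geodesic_between_sym[g [iso g0 gd ->]] sin; rewrite metric_sym in sin.
have d0 : 0 <= mdist y x by exact: mdist_ge0.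
exists (g s); first by exists s => //=; rewrite in_itv.
rewrite metric_sym -[in mdist y _]g0 iso ?in_itv//= ?lexx//.
by rewrite sub0r normrN ger0_norm//; case/andP: sin.
Qed.

End Geodesics.

(** * Vertices in the realization and on its geodesics *)

Section VertexGeodesics.
Context {R : realType} {G : graph}.
Implicit Types (p q : realization R G) (x y z v : vertex G).

Lemma mdist_Vertex x y : mdist (Vertex x : realization R G) (Vertex y) = (vdist x y)%:R.
Proof.
change (rdist (Vertex x : realization R G) (Vertex y) = (vdist x y)%:R).
by rewrite /= /dist_via /length_via /= !add0r !addr0 !minxx.
Qed.

(** A path from an interior point to [z] leaves the edge through an end, so the distance is an
    integer plus a number strictly between 0 and 1. *)
Lemma mdist_nat_Vertex {p z} {s : nat} : mdist p (Vertex z) = s%:R ->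
  exists v, p = Vertex v.
Proof.
case: p => [v _|e t]; first by exists v.
change (mdist (Interior e t) (Vertex z)) with (rdist (Interior e t) (@Vertex R G z)).
case: (rdistP (Interior e t) (@Vertex R G z)) => [[]//|[b [c ->]]].
rewrite /length_via /= addr0; move: (vdist _ _) => n; have /andP[t0 t1] := svalP t.
case: b => sn.
  have : (n < s)%N by rewrite -(ltr_nat R); lra.
  by rewrite leqNgt -(ltr_nat R) -natr1; lra.
have : (n < s)%N by rewrite -(ltr_nat R); lra.
by rewrite leqNgt -(ltr_nat R) -natr1; lra.
Qed.

Lemma geodesic_vertex_at {S x z} {s : nat} :
  geodesic_between S (@Vertex R G x) (Vertex z) -> (s <= vdist x z)%N ->
  exists2 v, S (Vertex v) & vdist v z = s.
Proof.
move=> geoS sx.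
have [|p Sp pz] := @geodesic_at _ _ _ _ _ s%:R geoS; first by rewrite mdist_Vertex ler0n ler_nat.
have [v pv] := mdist_nat_Vertex pz; exists v; rewrite -?pv//.
by apply/eqP; rewrite -(eqr_nat R) -mdist_Vertex -pv pz.
Qed.

Lemma vertex_ballP x v (r : nat) : vertex_ball x (r%:R : R) v <-> (vdist x v <= r)%N.
Proof. by rewrite /vertex_ball /cball /= mdist_Vertex ler_nat. Qed.

Lemma mdist_end_vertex p : mdist p (Vertex (end_vertex p false)) <= 1.
Proof.
apply: (le_trans (rdist_le p (Vertex (end_vertex p false)) false false)).
rewrite /length_via /= vdistxx !addr0; case: p => [v|e t] //=.
by have /andP[_ /ltW] := svalP t.
Qed.

Lemma vdist_end_vertex p q :
  (vdist (end_vertex p false) (end_vertex q false))%:R <= mdist p q + 2.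
Proof.
have pp := mdist_end_vertex p; have qq := mdist_end_vertex q.
rewrite -mdist_Vertex.
have := metric_triangle (Vertex (end_vertex p false)) p (Vertex (end_vertex q false)).
have := metric_triangle p q (Vertex (end_vertex q false)).
by rewrite [mdist (Vertex _) p]metric_sym; lra.
Qed.

End VertexGeodesics.

(** * Shells: inclusions, location and cardinal *)

Section Shells.
Context {R : realType} {G : graph} (L : set (set (realization R G))).
Implicit Types (x y z v : vertex G).

(* Levels below [T], where property B says nothing, are collapsed onto [z]. *)
Definition shell (T : nat) z x (s k : nat) : set (realization R G) :=
  if (s < T)%N then [set Vertex z] else
  [set Vertex v | v in [set v | vdist v z = s /\
    exists2 x', (vdist x x' <= k)%N & span_points L x' z (Vertex v)]].

(** The case [y = x] gives monotonicity in [k]; the case of adjacent vertices interleaves their two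
    chains. *)
Lemma subset_shell T z x y s k : (vdist x y <= 1)%N ->
  shell T z x s k `<=` shell T z y s k.+1.
Proof.
move=> xy p; rewrite /shell; case: ifP => // _ [v [vs [x' xx' vx']] <-].
exists v => //; split=> //; exists x' => //.
by apply: leq_trans (vdist_triangle x y x') _; rewrite vdistC -add1n leq_add.
Qed.

(** Below the cutoff, [p] is [z] and [vdist x z < T + r]. Otherwise [p] lies on a geodesic to [z]
    from some [x'] within [k] of [x], at distance at most [r + k] from [x']. *)
Lemma dist_shell T z x r k p : shell T z x (vdist x z - r) k p ->
  mdist (Vertex x) p <= (T + r + k + k)%:R.
Proof.
rewrite /shell; case: ltnP => [lt -> | _ [v [vs [x' xx' [S [_ geoS] Sv]]] <-]];
  rewrite mdist_Vertex ler_nat; first by lia.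
have := geodesicD geoS Sv; rewrite !mdist_Vertex -natrD => /eqP; rewrite eqr_nat => /eqP.
have := vdist_triangle x' x v; have := vdist_triangle x x' z; rewrite (vdistC x' x).
lia.
Qed.

Context {delta l : R} {D : nat}.
Context (hyp : hyperbolic (realization R G) delta).
Context (L_joins : forall u v : vertex G, joining L u v !=set0).
Context (LB : property_B L l (2 * delta) D).

(* A geodesic [x' -> z] stays [delta]-close to a geodesic [x -> z] away from the
   short side [x -> x'], so its vertex at level [s] is [2 * delta]-close to the
   vertex [c] of the latter at the same level. *)
Lemma shell_near {z x x' v c S} {k : nat} : (vdist x x' <= k)%N ->
  k%:R + delta < (vdist x v)%:R -> vdist v z = vdist c z ->
  span_points L x' z (Vertex v) ->
  geodesic_between S (@Vertex R G x) (Vertex z) -> S (Vertex c) ->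
  cball (Vertex c : realization R G) (2 * delta) (Vertex v).
Proof.
move=> xx' far vc [A [_ geoA] Av] geoS Sc.
have [C [_ geoC]] := L_joins x x'.
have [_ thin] := hyp.
have [|+ _ _] := thin A S C.
  by exists (Vertex x'), (Vertex z), (Vertex x); split=> //; apply: geodesic_between_sym.
move=> /(_ _ Av)[q [Sq|Cq] vq].
  (* As [c] and [q] lie on one geodesic to [z], their distance is the difference of their levels, at
     most [delta] because [v] has the level of [c]. *)
  have vz : mdist (Vertex v : realization R G) (Vertex z) = mdist (Vertex c) (Vertex z).
    by rewrite !mdist_Vertex vc.
  have cq := geodesic_dist geoS Sc Sq.
  have t1 := metric_triangle (Vertex v : realization R G) q (Vertex z).
  have t2 := metric_triangle q (Vertex v : realization R G) (Vertex z).
  have t3 := metric_triangle (Vertex c : realization R G) q (Vertex v).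
  rewrite (metric_sym q (Vertex v)) in t2 t3.
  have : mdist (Vertex c) q <= delta.
    by rewrite cq ler_norml; apply/andP; split; lra.
  by rewrite /cball /=; lra.
(* A point [q] on the short side would put [v] within [k + delta] of [x], against [far]. *)
have xq := geodesicD geoC Cq; have := mdist_ge0 q (Vertex x').
have t := metric_triangle (Vertex x : realization R G) q (Vertex v).
rewrite (metric_sym q (Vertex v)) !mdist_Vertex in xq t.
have : (vdist x x')%:R <= k%:R :> R by rewrite ler_nat.
lra.
Qed.

(** For [s >= T], the margin [T = m + c] keeps level [s] at least [k + l] from both [x] and [z], as
    property B requires for radius [k], and more than [k + delta] from [x], as [shell_near]
    requires. For [s < T] the shell is a point and [D] is positive. *)
Lemma shell_small {c T m : nat} {z x s k} : l <= c%:R -> delta < c%:R ->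
  T = (m + c)%N -> (0 < T)%N -> (k <= m)%N -> (s <= vdist x z - T)%N ->
  [/\ finite_set (shell T z x s k), shell T z x s k !=set0
    & (card (shell T z x s k) <= D)%N].
Proof.
move=> lc dc -> T0 km sx; have [l0 _ D0 B] := LB.
have finD A : (A #<= `I_D)%card -> finite_set A /\ (card A <= D)%N.
  move=> AD; split; last exact: geq_card_fset_set.
  by apply: card_le_finite AD _; apply: finite_II.
rewrite /shell; case: ltnP => [_|Ts].
  split; [exact: finite_set1| by exists (Vertex z)|].
  by rewrite /card fset_set1 cardfs1.
(* Since [0 < T <= s], the subtraction bounding [s] was not truncated. *)
have {}sx : (s + (m + c) <= vdist x z)%N by lia.
have [S [LS geoS]] := L_joins x z.
have [|w Sw ws] := geodesic_vertex_at geoS (_ : s <= _)%N; first lia.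
have xw : (vdist x w + s)%N = vdist x z.
  have := geodesicD geoS Sw; rewrite !mdist_Vertex ws -natrD => /eqP.
  by rewrite eqr_nat => /eqP.
have kmR : k%:R <= m%:R :> R by rewrite ler_nat.
have [|small _] := B x z k w (ex_intro2 _ _ S (conj LS geoS) Sw).
  rewrite le_min !mdist_Vertex ws (vdistC w x); apply/andP; split.
    apply: (@le_trans _ _ (m + c)%:R); first by rewrite natrD lerD.
    by rewrite ler_nat; lia.
  apply: (@le_trans _ _ (m + c)%:R); first by rewrite natrD lerD.
  by rewrite ler_nat; lia.
have sub : [set Vertex v | v in [set v | vdist v z = s /\
    exists2 x', (vdist x x' <= k)%N & span_points L x' z (Vertex v)]] `<=`
  @Vertex R G @` [set v | span_balls L x z k%:R (Vertex v) /\
     cball (Vertex w : realization R G) (2 * delta) (Vertex v)].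
  move=> _ [v [vs [x' xx' Gv]] <-]; exists v => //; split.
    have [A JA Av] := Gv; exists A => //; exists x'; first exact/vertex_ballP.
    by exists z => //; apply/vertex_ballP; rewrite vdistxx.
  apply: shell_near xx' _ _ Gv geoS Sw; last by rewrite vs ws.
  have : (m + c)%:R <= (vdist x v)%:R :> R.
    by rewrite ler_nat; have := vdist_triangle v x z; lia.
  by rewrite natrD; lra.
have [finS cardS] := finD _ _ (card_le_trans (subset_card_le sub)
  (card_le_trans (card_image_le _ _) small)).
split=> //; exists (Vertex w), w => //; split=> //; exists x; first by rewrite vdistxx.
by exists S.
Qed.

(** * Averages over radii and levels *)

Definition layer (w : R) (m T : nat) z x (s : nat) (p : realization R G) : R :=
  \sum_(0 <= k < m) uniform w (shell T z x s k) p.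

(** Starting [T] levels from [x] makes [shell_small] available at every level. Each shell then has
    mass [w], so [w = 1 / m ^ 2] yields a probability. *)
Definition average (w : R) (m T : nat) z x (p : realization R G) : R :=
  \sum_(0 <= t < m) layer w m T z x (vdist x z - T - t) p.

Lemma layer_ge0 w m T z x s p : 0 <= w -> 0 <= layer w m T z x s p.
Proof. by move=> w0; apply: sumr_ge0 => k _; apply: uniform_ge0. Qed.

Lemma average_ge0 w m T z x p : 0 <= w -> 0 <= average w m T z x p.
Proof. by move=> w0; apply: sumr_ge0 => k _; apply: layer_ge0. Qed.

Lemma average_support w m T z x p : average w m T z x p != 0 ->
  mdist (Vertex x) p <= (T + T + m + m + m)%:R.
Proof.
apply: contra_neqP => far; rewrite /average big_nat big1// => t /andP[_ tm].
rewrite /layer big_nat big1// => k /andP[_ km]; rewrite /uniform.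
case: ifPn => // /set_mem; rewrite -subnDA => /dist_shell pd; exfalso; apply: far.
by apply: le_trans pd _; rewrite ler_nat; lia.
Qed.

Section Scale.
Context {w : R} {c m T : nat}.
Context (w0 : 0 <= w).
Context (l_le : l <= c%:R).
Context (delta_lt : delta < c%:R).
Context (TE : T = (m + c)%N).
Context (T0 : (0 < T)%N).

Lemma l1norm_layer z x s : (s <= vdist x z - T)%N ->
  l1norm (layer w m T z x s) = (w * m%:R)%:E.
Proof.
move=> sx; rewrite l1norm_sum => [|k p]; last exact: uniform_ge0.
rewrite big_nat (eq_bigr (fun=> w%:E)) => [|k /andP[_ km]].
  by rewrite -big_nat sumEFin sumr_const_nat subn0 mulr_natr.
have [fin ne _] := shell_small l_le delta_lt TE T0 (ltnW km) sx.
exact: l1norm_uniform.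
Qed.

Lemma l1norm_average z x : l1norm (average w m T z x) = (w * m%:R * m%:R)%:E.
Proof.
rewrite l1norm_sum => [|k p]; last exact: layer_ge0.
rewrite (eq_bigr (fun=> (w * m%:R)%:E)) => [|t _].
  by rewrite sumEFin sumr_const_nat subn0 -[_ *+ _]mulr_natr.
by rewrite l1norm_layer ?leq_subr.
Qed.

Lemma l1dist_layer z x y s : (vdist x y <= 1)%N ->
  (s <= vdist x z - T)%N -> (s <= vdist y z - T)%N ->
  (l1norm (layer w m T z x s \- layer w m T z y s)%R <= (w * (4 * D)%:R)%:E)%E.
Proof.
move=> xy sx sy.
apply: le_trans (le_l1dist_sum _ _ _) _.
apply: l1dist_uniform_chain => // k.
- by move=> km; apply: (shell_small l_le delta_lt TE T0 km).
- by move=> km; apply: (shell_small l_le delta_lt TE T0 km).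
- by apply: subset_shell; rewrite vdistxx.
- by apply: subset_shell; rewrite vdistxx.
- exact: subset_shell.
- by apply: subset_shell; rewrite vdistC.
Qed.

(** At most [m] common levels cost [w * 4 * D] each; at most two unmatched layers have mass [w * m]
    each. *)
Lemma l1dist_average_adjacent z x y : (vdist x y <= 1)%N ->
  (l1norm (average w m T z x \- average w m T z y)%R <=
   (w * m%:R * (4 * D + 2)%:R)%:E)%E.
Proof.
wlog xy : x y / (vdist x z <= vdist y z)%N.
  by case: (leqP (vdist x z) (vdist y z)) => [?|/ltnW ?] H xy;
    [apply: H|rewrite l1normB; apply: H; rewrite // vdistC].
move=> xy1.
have near (n : nat) : (n <= m)%N -> (\sum_(0 <= t < n)
    l1norm (layer w m T z x (vdist x z - T - t) \-
            layer w m T z y (vdist x z - T - t))%R <=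
    (w * m%:R * (4 * D)%:R)%:E)%E.
  move=> nm; apply: (@le_trans _ _ (\sum_(0 <= t < n) (w * (4 * D)%:R)%:E)%E).
    by apply: lee_sum => t _; apply: l1dist_layer => //; lia.
  rewrite sumEFin sumr_const_nat subn0 lee_fin -[_ *+ n]mulr_natr mulrAC.
  by rewrite ler_wpM2r// ler_wpM2l// ler_nat.
(* Truncated subtraction may make the starting levels agree even when the distances to [z]
   differ. *)
have [yx|yx] : (vdist y z - T = vdist x z - T \/ vdist y z - T = (vdist x z - T).+1)%N.
  by have := vdist_triangle x y z; rewrite (vdistC y x); lia.
  rewrite /average yx.
  apply: le_trans (le_l1dist_sum _ _ _) _.
  apply: le_trans (near m _) _; rewrite // lee_fin ler_wpM2l ?mulr_ge0//.
  by rewrite ler_nat leq_addr.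
rewrite /average yx; apply: le_trans (le_l1dist_shift (layer w m T z x)
  (layer w m T z y) _ _) _.
rewrite !l1norm_layer//; [|lia|lia].
rewrite natrD mulrDr EFinD; apply: leeD; first exact/near/leq_pred.
by rewrite -EFinD lee_fin; lra.
Qed.

(** The estimate for adjacent vertices adds up along a shortest walk. *)
Lemma l1dist_average z x y :
  (l1norm (average w m T z x \- average w m T z y)%R <=
   ((vdist x y)%:R * (w * m%:R * (4 * D + 2)%:R))%:E)%E.
Proof.
move: (vdist_walk x y); move: (vdist x y) => j; elim: j x => [|j IHj] x /=.
  move=> ->; rewrite mul0r [_ \- _](_ : _ = cst 0) ?l1norm0//.
  by apply/funext => p /=; rewrite subrr.
move=> [v xv /IHj vy]; apply: le_trans (le_l1dist (average w m T z v) _ _) _.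
rewrite -natr1 mulrDl mul1r addrC EFinD; apply: leeD => //.
by apply: l1dist_average_adjacent; apply: vdist_min; exists v.
Qed.

End Scale.
End Shells.

(** * Convergence and the maps of property A1 *)

Lemma cvg_linear_modulus {R : realType} {X : metricType R}
    (a : nat -> X -> X -> R) (C : R) : 0 <= C ->
  (forall n x y, (l1norm (a n x \- a n y)%R <=
     ((mdist x y + 2) * (n.+1%:R^-1 * C))%:E)%E) ->
  forall K : R, 0 < K ->
    (fun n => ereal_sup (0%E |`
      [set l1norm (a n xy.1 \- a n xy.2) |
         xy in [set xy : X * X | mdist xy.1 xy.2 < K]])) @ \oo --> 0%E.
Proof.
move=> C0 aC K K0.
apply: (@squeeze_cvge _ _ _ _ (cst 0%E) _ (fun n => ((K + 2) * C * harmonic n)%:E)).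
- apply: nearW => n; apply/andP; split; first by apply: ereal_sup_ubound; left.
  apply: ge_ereal_sup => _ [->|[[x y] /= xyK <-]].
    by rewrite lee_fin !mulr_ge0 ?harmonic_ge0// addr_ge0// ltW.
  apply: le_trans (aC n x y) _; rewrite lee_fin -mulrA [C * _]mulrC.
  by rewrite ler_wpM2r ?mulr_ge0 ?lerD2r// ltW.
- exact: cvg_cst.
- rewrite -(mule0 ((K + 2) * C)%:E).
  have := cvgeZl (isT : ((K + 2) * C)%:E \is a fin_num) cvge_harmonic.
  exact.
Qed.

Theorem theorem4 (R : realType) (Gamma : graph) (delta l : R) (D : nat)
    (L : set (set (realization R Gamma)))
    (hyp : hyperbolic (realization R Gamma) delta)
    (L_geodesic : forall S, L S -> geodesic S)
    (L_joins : forall u v : vertex Gamma, joining L u v !=set0)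
    (LB : property_B L l (2 * delta) D) :
  property_A1 (realization R Gamma).
Proof.
have [[z]|noz] := pselect (inhabited (vertex Gamma)); last first.
  (* Without vertices the realization is empty, so the pointwise conditions are vacuous and the
     suprema are 0. *)
  have empty (p : realization R Gamma) : False.
    by apply: noz; constructor; exact: end_vertex p false.
  exists (fun _ _ _ => 0); split=> [n x|n x|n x y||]; try by case: (empty x).
    by exists (fun=> 0) => n x; case: (empty x).
  by apply: (@cvg_linear_modulus _ _ (fun _ _ _ => 0) 0) => // n x; case: (empty x).
have [c lc dc] : exists2 c : nat, l <= c%:R & delta < c%:R.
  have [l0 _ _ _] := LB; have [d0 _] := hyp.
  (* Both [l] and [delta] are nonnegative, so an integer above their sum exceeds each. *)
  exists (Num.truncn (l + delta)).+1; have := truncnS_gt (l + delta); lra.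
pose w n : R := (n.+1%:R * n.+1%:R)^-1.
have w0 n : 0 <= w n by rewrite invr_ge0 mulr_ge0.
have wn n : w n * n.+1%:R = n.+1%:R^-1.
  by rewrite /w invfM mulfVK// pnatr_eq0.
(* Here [m = n + 1], which is never 0, and each point borrows the average of its source end. *)
pose a n (x : realization R Gamma) := average L (w n) n.+1 (n.+1 + c) z (end_vertex x false).
have a1 n x : l1norm (a n x) = 1%E.
  rewrite (l1norm_average L hyp L_joins LB (w0 n) lc dc erefl)// wn mulVf//.
have a0 n x y : 0 <= a n x y by apply: average_ge0.
exists a; split=> //.
- by move=> n x; have := a1 n x; rewrite /summable /l1norm => ->; rewrite ltry.
(* The final 1 accounts for the distance from [x] to its source end. *)
- exists (fun n => (n.+1 + c + (n.+1 + c) + n.+1 + n.+1 + n.+1)%:R + 1) => n x y /=.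
  move=> /average_support xy; have := mdist_end_vertex x.
  have := metric_triangle x (Vertex (end_vertex x false)) y.
  by rewrite /cball /=; lra.
- apply: (@cvg_linear_modulus _ _ _ (4 * D + 2)%:R) => // n x y.
  apply: le_trans (l1dist_average L hyp L_joins LB (w0 n) lc dc erefl _ _ _ _) _ => //.
  by rewrite wn lee_fin ler_wpM2r ?mulr_ge0 ?vdist_end_vertex.
Qed.
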